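(* Let $N, M\geq 2$ be integers and let $c,k$ be real numbers. Let $X$ be an $N\times N$ Hermitian complex Hadamard matrix and let $Y$ be a signature $(c,N)$-matrix such that $$cX = kN I_N + XY + YX$$ (that is, $(X,Y)$ is an ETF-amicable pair of $N\times N$ matrices with constants $c$ and $k$). Let $S$ be a signature $(k,M)$-matrix. Then $$B = S\otimes X + I_M\otimes Y$$ is a signature $(c,MN)$-matrix.
   Context: A complex Hadamard matrix of order $N$ is an $N\times N$ complex matrix $H$ with all entries of absolute value $1$ and $HH^*=NI_N$. A signature $(c,N)$-matrix is an $N\times N$ complex matrix $S$ such that $S=S^*$, all diagonal entries of $S$ are $0$, all off-diagonal entries have absolute value $1$, and $S^2=cS+(N-1)I_N$, where $c=(N-2d)\sqrt{\frac{N-1}{d(N-d)}}$ for some integer $d$ with $1\leq d<N$. (These are exactly the signature matrices of equiangular tight frames of $N$ vectors in $\mathbb{C}^d$.) $\otimes$ denotes the Kronecker product and $I_N$ the identity matrix of order $N$. *)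

(* Defs.v *)
From mathcomp Require Import all_boot all_order all_algebra.
From mathcomp Require Import complex mxtens.
From mathcomp Require Import reals.

Set Implicit Arguments.
Unset Strict Implicit.
Unset Printing Implicit Defensive.

Import Order.TTheory GRing.Theory Num.Theory.
Local Open Scope ring_scope.
Local Open Scope complex_scope.
Local Open Scope sesquilinear_scope.

Definition complex_hadamard (R : realType) (N : nat) (H : 'M[R[i]]_N) : Prop :=
  (forall i j, `|H i j| = 1) /\ H *m H^t* = (N%:R)%:M.

(* The value of c is the one attained by equiangular tight frames of N vectors in
   dimension d; the square root is the real one. *)
Definition signature_matrix (R : realType) (c : R) (N : nat)
    (S : 'M[R[i]]_N) : Prop :=
  [/\ S \is hermsymmx,
      forall i, S i i = 0,
      forall i j, i != j -> `|S i j| = 1,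
      S *m S = c%:C *: S + (N%:R - 1)%:M
    & exists d : nat, (1 <= d < N)%N /\
        c = (N%:R - 2 * d%:R)
              * Num.sqrt ((N%:R - 1) / (d%:R * (N%:R - d%:R)))].

Definition ETF_amicable (R : realType) (c k : R) (N : nat)
    (X Y : 'M[R[i]]_N) : Prop :=
  [/\ X \is hermsymmx, complex_hadamard X, signature_matrix c Y
    & c%:C *: X = (k%:C * N%:R)%:M + X *m Y + Y *m X].

(* Main.v *)
(* The amicability relation makes the term S ⊗ (XY + YX) of B² equal to
   S ⊗ (cX - kN I), whose second part cancels the term k S ⊗ X² = kN S ⊗ I
   of S² ⊗ X²; the rest is c B + (MN - 1) I.
   The integer d then exists for any trace-zero matrix B of order n with
   B² = c B + (n - 1) I: with s = sqrt (c² + 4 (n - 1)), the matrix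
   (B + ((s - c) / 2) I) / s is idempotent, so its trace n (s - c) / (2 s) is
   its rank, and solving for c gives the required formula with d this rank. *)
Require Import Defs.
From mathcomp Require Import all_boot all_order all_algebra.
From mathcomp Require Import complex mxtens.
From mathcomp Require Import reals.
From mathcomp Require Import ring lra zify.

Import Order.TTheory GRing.Theory Num.Theory.

Local Open Scope ring_scope.
Local Open Scope complex_scope.
Local Open Scope sesquilinear_scope.

(** Factor [P] as C R with C of full column rank and R of full row rank. Cancelling C and R in C (R
    C) R = C R leaves R C = I of order [\rank P], and tr (C R) = tr (R C). *)
Lemma mxtrace_idempotent (F : fieldType) (n : nat) (P : 'M[F]_n) :
  P *m P = P -> \tr P = (\rank P)%:R.
Proof.
move=> PP; rewrite -{1}(mulmx_base P) mxtrace_mulC.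
suff -> : row_base P *m col_base P = 1%:M by rewrite mxtrace1.
apply: (row_full_inj (col_base_full P)).
apply: (row_free_inj (row_base_free P)).
by rewrite mulmx1 mulmx_base mulmxA mulmx_base -mulmxA mulmx_base.
Qed.

Lemma tensmxDl (R : comPzRingType) (m n p q : nat)
    (A1 A2 : 'M[R]_(m, n)) (B : 'M[R]_(p, q)) :
  (A1 + A2) *t B = A1 *t B + A2 *t B.
Proof. by apply/matrixP=> i j; rewrite !mxE mulrDl. Qed.

Lemma tensmxDr (R : comPzRingType) (m n p q : nat)
    (A : 'M[R]_(m, n)) (B1 B2 : 'M[R]_(p, q)) :
  A *t (B1 + B2) = A *t B1 + A *t B2.
Proof. by apply/matrixP=> i j; rewrite !mxE mulrDr. Qed.

Lemma tensmxZl (R : comPzRingType) (m n p q : nat) (a : R)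
    (A : 'M[R]_(m, n)) (B : 'M[R]_(p, q)) :
  (a *: A) *t B = a *: (A *t B).
Proof. by apply/matrixP=> i j; rewrite !mxE mulrA. Qed.

Lemma tensmxZr (R : comPzRingType) (m n p q : nat) (a : R)
    (A : 'M[R]_(m, n)) (B : 'M[R]_(p, q)) :
  A *t (a *: B) = a *: (A *t B).
Proof. by apply/matrixP=> i j; rewrite !mxE mulrCA. Qed.

Lemma tensmx11 (R : pzRingType) (m n : nat) :
  (1%:M : 'M[R]_m) *t (1%:M : 'M[R]_n) = 1%:M.
Proof.
apply/matrixP=> i j.
case: (mxtens_indexP i) => i1 i2; case: (mxtens_indexP j) => j1 j2.
by rewrite tensmxE !mxE (can_eq (@mxtens_indexK _ _)) xpair_eqE -natrM mulnb.
Qed.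

Lemma hermsymmxP (C : numClosedFieldType) (n : nat) (A : 'M[C]_n) :
  reflect (A = A^t*) (A \is hermsymmx).
Proof.
by rewrite is_hermitianmxE expr0 scale1r; apply: eqP.
Qed.

Lemma hermsymmx_tens (C : numClosedFieldType) (m n : nat)
    (A : 'M[C]_m) (B : 'M[C]_n) :
  A \is hermsymmx -> B \is hermsymmx -> A *t B \is hermsymmx.
Proof.
move=> /hermsymmxP hA /hermsymmxP hB; apply/hermsymmxP.
by rewrite trmx_tens map_mxT -hA -hB.
Qed.

Lemma hermsymmxD (C : numClosedFieldType) (n : nat) (A B : 'M[C]_n) :
  A \is hermsymmx -> B \is hermsymmx -> A + B \is hermsymmx.
Proof.
move=> /hermsymmxP hA /hermsymmxP hB; apply/hermsymmxP.
by rewrite linearD map_mxD -hA -hB.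
Qed.

Lemma trace0_quadratic_etf_constant (R : rcfType) (n : nat) (c : R)
    (B : 'M[R[i]]_n) :
  (1 < n)%N -> \tr B = 0 -> B *m B = c%:C *: B + (n%:R - 1)%:M ->
  exists d : nat, (1 <= d < n)%N /\
    c = (n%:R - 2 * d%:R) * Num.sqrt ((n%:R - 1) / (d%:R * (n%:R - d%:R))).
Proof.
move=> n_gt1 trB0 BB.
have n1 : 1 < n%:R :> R by rewrite ltr1n.
set s := Num.sqrt (c ^+ 2 + 4 * (n%:R - 1)).
have s2 : s ^+ 2 = c ^+ 2 + 4 * (n%:R - 1) by rewrite sqr_sqrtr //; nra.
have s0 : 0 < s by rewrite sqrtr_gt0; nra.
(* Since n > 1, s exceeds |c|; this will place the rank strictly between 0 and n. *)
have c_lts : c < s by nra.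
have c_gtNs : - s < c by nra.
(* The map x -> a x + b sends the roots (c + s) / 2 and (c - s) / 2 of x^2 = c x + (n - 1) to 1 and
   0. *)
set a := s^-1; set b := (s - c) / (2 * s).
pose P := a%:C *: B + (b%:C)%:M.
(* [ab1] and [ab2] compare the coefficients of [B] and of I in P^2 = P, once B^2 is reduced by the
   quadratic relation. *)
have ab1 : a ^+ 2 * c + 2 * a * b = a by rewrite /a /b; field; rewrite gt_eqF.
have ab2 : a ^+ 2 * (n%:R - 1) + b ^+ 2 = b.
  have -> : n%:R - 1 = (s ^+ 2 - c ^+ 2) / 4 by lra.
  by rewrite /a /b; field; rewrite gt_eqF.
have PP : P *m P = P.
  clearbody a b.
  rewrite /P mulmxDl !mulmxDr -scalar_mxM mul_mx_scalar mul_scalar_mx.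
  rewrite -scalemxAl -scalemxAr BB.
  apply/matrixP=> i j; rewrite !mxE.
  have ab1C := congr1 (real_complex R) ab1.
  have ab2C := congr1 (real_complex R) ab2.
  rewrite !(rmorphD, rmorphM, rmorphXn, rmorphN, rmorph1, rmorph_nat) /= in
    ab1C ab2C.
  transitivity ((a%:C ^+ 2 * c%:C + 2 * a%:C * b%:C) * B i j +
      (a%:C ^+ 2 * (n%:R - 1) + b%:C ^+ 2) *+ (i == j)); last first.
    by congr (_ * _ + _ *+ _); [rewrite -[RHS]ab1C | rewrite -[RHS]ab2C]; ring.
  by case: (i == j); rewrite ?mulr1n ?mulr0n; ring.
have trP := mxtrace_idempotent _ _ _ PP.
set r := \rank P in trP.
(* The trace identity lives in [R[i]]; injectivity of the real embedding brings it down to [R]. *)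
have {trP} r_eq : n%:R * b = r%:R.
  apply: complexI; rewrite rmorphM /= !rmorph_nat -trP.
  by rewrite /P mxtraceD mxtraceZ trB0 mulr0 add0r mxtrace_scalar mulr_natl.
have nr_eq : n%:R - r%:R = n%:R * ((s + c) / (2 * s)) :> R.
  by rewrite -r_eq /b; field; rewrite gt_eqF.
have r_gt0 : 0 < r%:R :> R.
  by rewrite -r_eq !mulr_gt0 ?invr_gt0 ?mulr_gt0 ?subr_gt0 //; lra.
have nr_gt0 : 0 < n%:R - r%:R :> R.
  by rewrite nr_eq !mulr_gt0 ?invr_gt0 ?mulr_gt0 //; lra.
exists r; split; first by rewrite -(ltr0n R) r_gt0 -(ltr_nat R) -subr_gt0.
have n_neq0 : n%:R != 0 :> R by rewrite pnatr_eq0 -lt0n ltnW.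
have s_neq0 : s != 0 by rewrite gt_eqF.
(* Here r (n - r) = n^2 (s^2 - c^2) / (4 s^2), while n - 1 = (s^2 - c^2) / 4. *)
have -> : (n%:R - 1) / (r%:R * (n%:R - r%:R)) = (s / n%:R) ^+ 2 :> R.
  have -> : n%:R - 1 = (s ^+ 2 - c ^+ 2) / 4 :> R by lra.
  rewrite nr_eq -r_eq /b; field.
  by rewrite n_neq0 s_neq0 !lt0r_neq0 //; lra.
rewrite sqrtr_sqr ger0_norm; last by rewrite divr_ge0 ?ler0n // ltW.
(* It remains that n - 2 r = n c / s. *)
by rewrite -r_eq /b; field; rewrite n_neq0 s_neq0.
Qed.

Lemma etf_amicable_tens_sqr (R : realType) (N M : nat) (c k : R)
    (X Y : 'M[R[i]]_N) (S : 'M[R[i]]_M) :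
  X *m X = (N%:R)%:M ->
  Y *m Y = c%:C *: Y + (N%:R - 1)%:M ->
  c%:C *: X = (k%:C * N%:R)%:M + X *m Y + Y *m X ->
  S *m S = k%:C *: S + (M%:R - 1)%:M ->
  let B := S *t X + 1%:M *t Y in
  B *m B = c%:C *: B + ((M * N)%:R - 1)%:M.
Proof.
move=> XX YY cX SS B.
have XYYX : X *m Y + Y *m X = c%:C *: X + (- (k%:C * N%:R)) *: 1%:M.
  by rewrite cX -scalemx1 scaleNr -[X in X - _]addrA [RHS]addrC addKr.
rewrite mulmxDl !mulmxDr !tensmx_mul !mul1mx !mulmx1.
(* Regrouping puts the cross terms S ⊗ XY and S ⊗ YX side by side, so that they merge into S ⊗ (XY +
   YX). *)
rewrite addrA -[X in X + _]addrA -tensmxDr XYYX XX YY SS.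
rewrite -![(_ - 1)%:M]scalemx1 -[N%:R%:M]scalemx1.
rewrite !(tensmxDl, tensmxDr, tensmxZl, tensmxZr) tensmx11 /B.
(* With the three tensor products as atoms the goal is linear in them; the identity parts add up by
   (M - 1) N + (N - 1) = MN - 1. *)
move: (S *t X) (S *t 1%:M) (1%:M *t Y) => SX S1 Y1.
by apply/matrixP=> i j; rewrite !mxE natrM; ring.
Qed.

Theorem theorem1 (R : realType) (N M : nat) (c k : R)
  (X Y : 'M[R[i]]_N) (S : 'M[R[i]]_M) :
  (2 <= N)%N -> (2 <= M)%N ->
  ETF_amicable c k X Y ->
  signature_matrix k S ->
  signature_matrix c (S *t X + 1%:M *t Y).
Proof.
move=> N2 M2 [hX [X1 XXt] [hY Y0 Y1 YY _] cX] [hS S0 S1 SS _].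
have XX : X *m X = (N%:R)%:M by rewrite -XXt -(hermsymmxP _ _ _ hX).
have BB := etf_amicable_tens_sqr _ _ _ _ _ _ _ _ XX YY cX SS.
have B0 i : (S *t X + 1%:M *t Y) i i = 0.
  case: (mxtens_indexP i) => i1 i2.
  by rewrite mxE !tensmxE S0 Y0 mul0r mulr0 addr0.
split=> //.
- by rewrite hermsymmxD ?hermsymmx_tens // hermitian1mx_subproof.
- move=> i j; case: (mxtens_indexP i) => i1 i2.
  case: (mxtens_indexP j) => j1 j2.
  rewrite mxE !tensmxE mxE (can_eq (@mxtens_indexK _ _)) xpair_eqE.
  (* A diagonal block is [Y], because [S] has zero diagonal; an off-diagonal block is a unimodular
     multiple of [X]. *)
  have [-> /=|ne _] := eqVneq i1 j1.
    by move=> ne; rewrite S0 mul0r add0r mul1r Y1.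
  by rewrite mul0r addr0 normrM S1 // X1 mulr1.
- apply: trace0_quadratic_etf_constant BB; first by nia.
  by rewrite /mxtrace big1.
Qed.
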